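(* Let $a\in\mathbb{R}$ and let $w$ be a constant connection strength graphon with strength $a$, i.e. a graphon such that $\int_I w(x,y)\,dy=a$ for all $x\in I$. Assume that for every $\boldsymbol{\alpha}\in\mathbb{A}$ there is a unique $\mathbf{z}\in L^2(I)$ with $z_x=\int_I w(x,y)b(\alpha_y,z_y)\,dy$ for a.e. $x\in I$ (so that $\mathbf{Z}$ is well defined). Suppose there exists a Nash equilibrium $\hat\alpha\in A$ for the mean field game with constant $a$. Then $\hat{\boldsymbol{\alpha}}$ defined by $\hat\alpha_x=\hat\alpha$ for every $x\in I$ is a Nash equilibrium for the graphon game with graphon $w$.
   Context: $I=[0,1]$ with Lebesgue measure; $L^2(I)$ is the usual real Lebesgue space. $A\subset\mathbb{R}$ is a nonempty closed convex set of actions, and $\mathbb{A}$ is the set of $\boldsymbol{\alpha}\in L^2(I)$ with values in $A$ (admissible strategy profiles). $\mu_0$ is a mean-zero probability measure on $\mathbb{R}$ with finite second moment, $\xi_0\sim\mu_0$; $b:A\times\mathbb{R}\to\mathbb{R}$ and $f:\mathbb{R}\times A\times\mathbb{R}\to\mathbb{R}$ are given functions, and $\mathcal{J}(\alpha,z)=\mathbb{E}[f(b(\alpha,z)+\xi_0,\alpha,z)]$ for $(\alpha,z)\in A\times\mathbb{R}$ (assumed well defined). Graphon game: a graphon is a symmetric Borel measurable square-integrable function $w:I\times I\to\mathbb{R}$. For $\boldsymbol{\alpha}\in\mathbb{A}$, $\mathbf{Z}\boldsymbol{\alpha}$ denotes the unique $\mathbf{z}\in L^2(I)$ with $z_x=\int_I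 w(x,y)b(\alpha_y,z_y)\,dy$ for a.e. $x$. A player $x$ using action $\alpha\in A$ while the others use $\boldsymbol{\alpha}$ incurs cost $\mathcal{J}(\alpha,[\mathbf{Z}\boldsymbol{\alpha}]_x)$. A Nash equilibrium for the graphon game is $\hat{\boldsymbol{\alpha}}\in\mathbb{A}$ such that for a.e. $x\in I$, $\mathcal{J}(\hat\alpha_x,[\mathbf{Z}\hat{\boldsymbol{\alpha}}]_x)\le\mathcal{J}(\beta,[\mathbf{Z}\hat{\boldsymbol{\alpha}}]_x)$ for all $\beta\in A$. Mean field game (MFG) with constant $a$: $\hat\alpha\in A$ is a Nash equilibrium if $\mathcal{J}(\hat\alpha,\hat z)\le\mathcal{J}(\beta,\hat z)$ for all $\beta\in A$, where $\hat z\in\mathbb{R}$ is the unique solution of $\hat z=a\,\mathbb{E}[b(\hat\alpha,\hat z)+\xi_0]$. *)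

(* Defs.v *)
From HB Require Import structures.
From mathcomp Require Import all_boot all_order all_algebra.
From mathcomp Require Import all_classical all_reals all_analysis.

Set Implicit Arguments.
Unset Strict Implicit.
Unset Printing Implicit Defensive.

Import Order.TTheory GRing.Theory Num.Theory.
Import numFieldNormedType.Exports.

Local Open Scope classical_set_scope.
Local Open Scope ring_scope.
Local Open Scope ereal_scope.

(* An element of L^2(I) is represented by a function R -> R of which only the
   values on I matter (equality in L^2(I) is a.e. equality on I); similarly, b
   and f are total functions whose action argument is only used in A. *)

Definition I01 (R : realType) : set R := `[0%R, 1%R].

(* f \_ D is f extended by 0 outside D, so that f \_ D being in L^2 of the
   ambient space says that f is measurable and square-integrable on D. *)
Definition L2I (R : realType) (f : R -> R) : Prop :=
  (f \_ (@I01 R)) \in Lfun (@lebesgue_measure R) 2%:E.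

Definition admissible (R : realType) (A : set R) (alpha : R -> R) : Prop :=
  L2I alpha /\ forall x, I01 x -> A (alpha x).

Definition graphon (R : realType) (w : R * R -> R) : Prop :=
  (forall x y, I01 x -> I01 y -> w (x, y) = w (y, x)) /\
  (w \_ (@I01 R `*` @I01 R))
    \in Lfun (@lebesgue_measure R \x @lebesgue_measure R) 2%:E.

Definition constant_strength (R : realType) (w : R * R -> R) (a : R) : Prop :=
  forall x, I01 x ->
    (@lebesgue_measure R).-integrable (@I01 R) (fun y => (w (x, y))%:E) /\
    \int[@lebesgue_measure R]_(y in @I01 R) (w (x, y))%:E = a%:E.

(* z is in L^2(I) and z_x = \int_I w(x,y) b(alpha_y, z_y) dy for a.e. x in I;
   the integral being meaningful is part of the equation. *)
Definition aggregate_eq (R : realType) (w : R * R -> R) (b : R -> R -> R)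
    (alpha z : R -> R) : Prop :=
  L2I z /\
  {ae @lebesgue_measure R, forall x, I01 x ->
    (@lebesgue_measure R).-integrable (@I01 R)
      (fun y => (w (x, y) * b (alpha y) (z y))%:E) /\
    (z x)%:E = \int[@lebesgue_measure R]_(y in @I01 R)
                 (w (x, y) * b (alpha y) (z y))%:E}.

Definition aggregate_well_posed (R : realType) (A : set R) (w : R * R -> R)
    (b : R -> R -> R) : Prop :=
  forall alpha, admissible A alpha ->
    exists2 z, aggregate_eq w b alpha z &
      forall z', aggregate_eq w b alpha z' ->
        ae_eq (@lebesgue_measure R) (@I01 R) z z'.

(* The operator Z: a representative of the a.e.-unique solution (and the junk
   value 0 when there is no solution). *)
Definition aggregate (R : realType) (w : R * R -> R) (b : R -> R -> R)
    (alpha : R -> R) : R -> R :=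
  xget (cst 0%R) [set z | aggregate_eq w b alpha z].

Section Games.
Context (R : realType) (d : measure_display) (Omega : measurableType d).
Context (P : probability Omega R) (xi0 : {RV P >-> R}).
Implicit Types (A : set R) (b : R -> R -> R) (f : R -> R -> R -> R).

Definition cost_var b f (alpha z : R) (omega : Omega) : R :=
  f (b alpha z + xi0 omega)%R alpha z.

(* Its values are extended reals because expectations are; cost_well_defined
   makes them finite for actions in A. *)
Definition cost b f (alpha z : R) : \bar R := 'E_P[cost_var b f alpha z].

Definition cost_well_defined A b f : Prop :=
  forall alpha z, A alpha ->
    P.-integrable setT (fun omega => (cost_var b f alpha z omega)%:E).

Definition graphon_nash A b f (w : R * R -> R) (alpha : R -> R) : Prop :=
  admissible A alpha /\
  {ae @lebesgue_measure R, forall x, I01 x -> forall beta, A beta ->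
    cost b f (alpha x) (aggregate w b alpha x) <=
    cost b f beta (aggregate w b alpha x)}.

Definition mfg_aggregate_eq b (a alpha z : R) : Prop :=
  z%:E = a%:E * 'E_P[fun omega => (b alpha z + xi0 omega)%R].

Definition mfg_nash A b f (a alpha : R) : Prop :=
  A alpha /\
  exists2 z, unique (mfg_aggregate_eq b a alpha) z &
    forall beta, A beta -> cost b f alpha z <= cost b f beta z.

End Games.

(* Main.v *)
Require Import Defs.
From HB Require Import structures.
From mathcomp Require Import all_boot all_order all_algebra.
From mathcomp Require Import all_classical all_reals all_analysis.
From mathcomp Require Import measurable_realfun.

(** When everybody plays the mean field action, almost every player faces the
    mean field aggregate.  Let [z] be the mean field aggregate of the action
    [alphahat].  The noise is centered, so the mean field equation reads
    [z = a * b(alphahat, z)].  Every row of the graphon integrates to [a], so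
    [a * b(alphahat, z)] is also the integral over [y] in [I] of
    [w(x, y) * b(alphahat, z)]: the function constantly equal to
    [z] solves the graphon equation for the constant profile
    ([aggregate_eq_cst]).  By uniqueness the graphon aggregate is equal to [z]
    almost everywhere ([aggregate_unique]), and for the players where it is, the
    equilibrium inequality of the graphon game is that of the mean field game.

    The only analytic points are that the noise is integrable, which is what
    makes the expectation in the mean field equation additive
    ([expectation_shift_centered]), and that constants are square-integrable on
    a set of finite measure ([Lfun2_patch_cst]), which puts the constant profile
    among the admissible ones and its aggregate among the candidates in L^2(I). *)

Set Implicit Arguments.
Unset Strict Implicit.
Unset Printing Implicit Defensive.

Import Order.TTheory GRing.Theory Num.Theory.
Import numFieldNormedType.Exports.

Local Open Scope classical_set_scope.
Local Open Scope ring_scope.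
Local Open Scope ereal_scope.

Lemma Lfun2_of_integral_sqr_lty d (T : measurableType d) (R : realType)
    (mu : {measure set T -> \bar R}) (g : T -> R) :
  measurable_fun [set: T] g -> \int[mu]_x (g x ^+ 2)%:E < +oo ->
  g \in Lfun mu 2%:E.
Proof.
move=> mg g2; rewrite inE; apply/andP; split; rewrite inE//=.
rewrite /finite_norm unlock poweR_lty//.
under eq_integral => x _ do
  rewrite /= powR_mulrn// -normrX ger0_norm ?sqr_ge0//.
by [].
Qed.

Lemma Lfun2_patch_cst d (T : measurableType d) (R : realType)
    (mu : {measure set T -> \bar R}) (D : set T) (c : R) :
  measurable D -> mu D < +oo -> ((cst c : T -> R) \_ D) \in Lfun mu 2%:E.
Proof.
move=> mD muD; apply: Lfun2_of_integral_sqr_lty.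
  by apply: (iffLR (measurable_restrictT _ mD)); exact: measurable_cst.
rewrite (_ : (fun x => _) = (cst (c ^+ 2)%:E) \_ D); last first.
  by apply/funext => x; rewrite !patchE; case: ifPn => _; rewrite ?expr0n.
rewrite -integral_mkcond integral_cst//.
by rewrite lte_mul_pinfty// lee_fin sqr_ge0.
Qed.

Lemma L2I_cst (R : realType) (c : R) : L2I (cst c).
Proof.
apply: Lfun2_patch_cst; first exact: measurable_itv.
by rewrite /= /I01 lebesgue_measure_itv/= lte_fin ltr01 -EFinD ltry.
Qed.

(** Changing variables to the law of [X] in the signed integral defining its
    mean needs [X] integrable; its square is nonnegative, so the second moment
    can be transferred first, and it gives integrability because [P] is finite. *)
Lemma expectation_shift_centered d (Omega : measurableType d) (R : realType)
    (P : probability Omega R) (X : {RV P >-> R}) (m : probability R R) (c : R) :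
  (forall B : set R, measurable B -> distribution P X B = m B) ->
  \int[m]_e e%:E = 0 -> \int[m]_e (e ^+ 2)%:E < +oo ->
  'E_P[fun omega => (c + X omega)%R] = c%:E.
Proof.
move=> lawX m0 m2.
have XL2 : (X : Omega -> R) \in Lfun P 2%:E.
  apply: Lfun2_of_integral_sqr_lty => //.
  rewrite -(@ge0_integral_distribution _ _ _ _ _ P X (fun e => (e ^+ 2)%:E)).
  - by rewrite (@eq_measure_integral _ _ _ _ m) // => B mB _; exact: lawX.
  - by apply/measurable_EFinP; exact: measurable_funX.
  - by move=> e; rewrite lee_fin sqr_ge0.
have XL1 : (X : Omega -> R) \in Lfun P 1.
  by apply: Lfun_subset12 XL2; exact: fin_num_measure.
have EX : 'E_P[X] = 0.
  rewrite unlock -m0 -(@integral_distribution _ _ _ _ _ P X EFin) //.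
  - by apply: eq_measure_integral => B mB _; exact: lawX.
  - exact/Lfun1_integrable.
have := expectationD (Lfun_cst P c 1) XL1.
by rewrite expectation_cst EX adde0.
Qed.

(** With [alpha] and [z] constant the integrand is a scalar multiple of the row
    [w (x, .)]: it is integrable because the row is, and its integral is
    [a * b alpha z] for every player [x]. *)
Lemma aggregate_eq_cst (R : realType) (w : R * R -> R) (b : R -> R -> R)
    (a alpha z : R) :
  constant_strength w a -> z = (a * b alpha z)%R ->
  aggregate_eq w b (fun=> alpha) (cst z).
Proof.
move=> wa zE; split; first exact: L2I_cst.
apply/nearW => x Ix; have [wint wE] := wa x Ix; split.
  under eq_fun => y do rewrite /= EFinM.
  by apply: integrableZr => //; exact: measurable_itv.
under eq_integral => y _ do rewrite /= EFinM.
rewrite integralZr ?wE; [|exact: measurable_itv|by []].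
by rewrite /= -EFinM -zE.
Qed.

(** [aggregate] is a chosen representative, so it matches a given solution only
    up to a null set, even when that solution holds pointwise. *)
Lemma aggregate_unique (R : realType) (A : set R) (w : R * R -> R)
    (b : R -> R -> R) (alpha z : R -> R) :
  aggregate_well_posed A w b -> admissible A alpha ->
  aggregate_eq w b alpha z ->
  ae_eq (@lebesgue_measure R) (@I01 R) (aggregate w b alpha) z.
Proof.
move=> wp adm zsol; have [z0 _ uniq] := wp _ adm.
have Zsol : aggregate_eq w b alpha (aggregate w b alpha).
  exact: (@xgetI _ _ [set z' | aggregate_eq w b alpha z'] z).
exact: ae_eq_trans (ae_eq_sym (uniq _ Zsol)) (uniq _ zsol).
Qed.

Theorem proposition3p12 (R : realType) (A : set R)
  (A_nonempty : A !=set0) (A_closed : closed A)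
  (A_convex : convex_set (A : set (convex_lmodType R^o)))
  (mu0 : probability R R)
  (mu0_mean : \int[mu0]_e e%:E = 0)
  (mu0_moment2 : \int[mu0]_e (e ^+ 2)%:E < +oo)
  (d : measure_display) (Omega : measurableType d) (P : probability Omega R)
  (xi0 : {RV P >-> R})
  (xi0_law : forall B : set R, measurable B -> distribution P xi0 B = mu0 B)
  (b : R -> R -> R) (f : R -> R -> R -> R)
  (J_well_defined : cost_well_defined xi0 A b f)
  (a : R) (w : R * R -> R)
  (w_graphon : graphon w) (w_strength : constant_strength w a)
  (Z_well_defined : aggregate_well_posed A w b)
  (alphahat : R) (alphahat_nash : mfg_nash xi0 A b f a alphahat) :
  graphon_nash xi0 A b f w (fun _ : R => alphahat).
Proof.
have [Aalpha [z [zMFG _] zopt]] := alphahat_nash.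
have zE : z = (a * b alphahat z)%R.
  apply: EFin_inj; rewrite [LHS]zMFG EFinM.
  by rewrite (expectation_shift_centered _ xi0_law).
have adm : admissible A (fun _ : R => alphahat).
  by split => //; exact: L2I_cst.
split=> //.
have := aggregate_unique Z_well_defined adm (aggregate_eq_cst w_strength zE).
apply: filterS => x + Ix beta Abeta.
by move=> /(_ Ix) ->; exact: zopt.
Qed.
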